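(* Let $1 \le \alpha < 2$, let $n \ge 1$, let $\beta \in \mathbb{C}$ be a fixed constant, and let $\underline{a_{ij}} \le \overline{a_{ij}}$ ($1 \le i,j \le n$) be real numbers. Let $\mathcal{A}^I$ be the set of real $n\times n$ matrices $[a_{ij}]$ with $a_{ij} \in [\underline{a_{ij}}, \overline{a_{ij}}]$ for all $i,j$, and let $\mathcal{A}^v \subset \mathcal{A}^I$ be the finite set of those with $a_{ij} \in \{\underline{a_{ij}}, \overline{a_{ij}}\}$ for all $i,j$. Then the fractional-order interval system $\frac{\mathrm{d}^\alpha x(t)}{\mathrm{d}t^\alpha} = A x(t)$, $A \in \mathcal{A}^I$, is quadratically stable if and only if there exists a common Hermitian positive-definite matrix $P = P^\ast > 0$ in $\mathbb{C}^{n\times n}$ such that $$\overline{\lambda}\left(\beta P A + \beta^\ast A^T P\right) < 0 \quad \text{for all } A \in \mathcal{A}^v,$$ where $\overline{\lambda}(H)$ denotes the maximum eigenvalue of a Hermitian matrix $H$.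
   Context: For a complex number, $\beta^\ast$ is the complex conjugate; for a complex matrix, $P^\ast$ is the conjugate transpose. For Hermitian $H$, $H>0$ (resp. $H<0$) means positive (resp. negative) definite. Definition (quadratic stability). The fractional-order interval system $\frac{\mathrm{d}^\alpha x(t)}{\mathrm{d}t^\alpha} = A x(t)$, $A \in \mathcal{A}^I$, is called quadratically stable if there exists a single Hermitian positive-definite matrix $P = P^\ast > 0$ in $\mathbb{C}^{n\times n}$ (the same for all $A$) such that $\beta P A + \beta^\ast A^T P < 0$ for all $A \in \mathcal{A}^I$. The definition of quadratic stability is this matrix-inequality condition; the constant $\beta$ is the same one in the definition and in the vertex condition. *)

(* Defs.v *)
From mathcomp Require Import all_boot all_order all_algebra.
From mathcomp Require Import complex.
From mathcomp Require Import all_classical reals.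

Set Implicit Arguments.
Unset Strict Implicit.
Unset Printing Implicit Defensive.

Import Order.TTheory GRing.Theory Num.Theory.
Local Open Scope classical_set_scope.
Local Open Scope ring_scope.
Local Open Scope complex_scope.
Local Open Scope sesquilinear_scope.

(* On R[i], [0 < z] means that z is real and positive. *)
Definition posdefmx (R : realType) (n : nat) (H : 'M[R[i]]_n) : Prop :=
  H \is hermsymmx /\
  forall x : 'cV[R[i]]_n, x != 0 -> 0 < (x ^t* *m H *m x) 0 0.

Definition negdefmx (R : realType) (n : nat) (H : 'M[R[i]]_n) : Prop :=
  H \is hermsymmx /\
  forall x : 'cV[R[i]]_n, x != 0 -> (x ^t* *m H *m x) 0 0 < 0.

(* Meaningful for Hermitian H with 0 < n: the spectrum is then a nonempty
   finite set of reals, and the supremum is its maximum. *)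
Definition lambda_max (R : realType) (n : nat) (H : 'M[R[i]]_n) : R :=
  sup [set l : R | eigenvalue H l%:C].

(* The interval system d^alpha x / dt^alpha = A x, with A ranging over the real
   matrices lying entrywise between [lower] and [upper]. *)
Record interval_system (R : realType) (n : nat) := IntervalSystem {
  sys_order : R;
  lower : 'M[R]_n;
  upper : 'M[R]_n }.

Definition interval_matrices (R : realType) (n : nat)
    (S : interval_system R n) : set 'M[R]_n :=
  [set A | forall i j, lower S i j <= A i j <= upper S i j].

Definition vertex_matrices (R : realType) (n : nat)
    (S : interval_system R n) : set 'M[R]_n :=
  [set A | forall i j, A i j = lower S i j \/ A i j = upper S i j].

(* beta P A + beta^* A^T P *)
Definition lyapunov_mx (R : realType) (n : nat) (beta : R[i])
    (P : 'M[R[i]]_n) (A : 'M[R]_n) : 'M[R[i]]_n :=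
  let AC := map_mx (real_complex R) A in
  beta *: (P *m AC) + beta^* *: (AC^T *m P).

(* Quadratic stability is by definition the matrix inequality: the order of the
   system does not occur in it. *)
Definition quadratically_stable (R : realType) (n : nat) (beta : R[i])
    (S : interval_system R n) : Prop :=
  exists P : 'M[R[i]]_n, posdefmx P /\
    forall A, interval_matrices S A -> negdefmx (lyapunov_mx beta P A).

Lemma hermsymmx_eigenvalue_real (R : realType) (n : nat) (H : 'M[R[i]]_n) a :
  H \is hermsymmx -> eigenvalue H a -> a = (complex.Re a)%:C.
Proof.
move=> /is_hermitianmxP; rewrite expr0 scale1r => Hh.
move=> /eigenvalueP[v vH v0].
have ha : a * (v *m v ^t*) 0 0 = Num.conj a * (v *m v ^t*) 0 0.
  have e1 : v *m H *m v ^t* = a *: (v *m v ^t*) by rewrite vH -scalemxAl.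
  have e2 : v *m H *m v ^t* = Num.conj a *: (v *m v ^t*).
    rewrite {1}Hh -mulmxA.
    have -> : H ^t* *m v ^t* = Num.conj a *: v ^t*.
      by rewrite -map_mxM -trmx_mul vH linearZ /= map_mxZ.
    by rewrite -scalemxAr.
  by move: e1; rewrite e2 => /matrixP/(_ 0 0); rewrite !mxE.
have vv : (v *m v ^t*) 0 0 != 0.
  by rewrite -dotmxE dnorm_eq0.
have /CrealP : Num.conj a = a by apply: (mulIf vv).
by case: a {vH ha} => x y; rewrite complex_real => /eqP ->.
Qed.

Lemma lambda_maxP (R : realType) (n : nat) (H : 'M[R[i]]_n) :
  (0 < n)%N -> H \is hermsymmx ->
  eigenvalue H (lambda_max H)%:C /\
  forall a, eigenvalue H a -> a <= (lambda_max H)%:C.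
Proof.
move=> n0 Hh.
have [rs Ers] := closed_field_poly_normal (char_poly H).
have inrs a : eigenvalue H a = (a \in rs).
  rewrite eigenvalue_root_char Ers rootZ ?root_prod_XsubC//.
  by rewrite (monicP (char_poly_monic H)) oner_eq0.
have [a0 a0H] := eigenvalue_closed H n0.
have [m mH mub] : exists2 m, eigenvalue H m &
    forall a, eigenvalue H a -> complex.Re a <= complex.Re m.
  rewrite inrs in a0H.
  have := a0H; rewrite -index_mem => i0.
  pose j := [arg max_(j > Ordinal i0) complex.Re rs`_(val j)]%O.
  exists rs`_(val j); first by rewrite inrs mem_nth ?ltn_ord.
  move=> a; rewrite inrs => ars; rewrite /j.
  case: (@Order.TotalTheory.arg_maxP _ R _ (Ordinal i0) xpredT
    (fun k => complex.Re rs`_(val k)) isT) => /= k _.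
  move=> /(_ (Ordinal (etrans (index_mem a rs) ars)) isT) /=.
  by rewrite nth_index.
have mR := hermsymmx_eigenvalue_real Hh mH.
suff -> : lambda_max H = complex.Re m.
  rewrite -mR; split=> // a aH.
  by rewrite mR (hermsymmx_eigenvalue_real Hh aH) lecR mub.
have ubm : ubound [set l : R | eigenvalue H l%:C] (complex.Re m).
  by move=> l /= /mub.
have Sm : [set l : R | eigenvalue H l%:C] (complex.Re m) by rewrite /= -mR.
apply/eqP; rewrite eq_le; apply/andP; split.
- by apply: ge_sup => //; exists (complex.Re m).
- by apply: ub_le_sup => //; exists (complex.Re m).
Qed.

Lemma lyapunov_mx_hermsym (R : realType) (n : nat) (beta : R[i])
    (P : 'M[R[i]]_n) (A : 'M[R]_n) :
  P \is hermsymmx -> lyapunov_mx beta P A \is hermsymmx.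
Proof.
move=> /is_hermitianmxP; rewrite expr0 scale1r => Ph.
have Ac : (map_mx (real_complex R) A) ^ Num.conj = map_mx (real_complex R) A.
  apply/matrixP => i j; rewrite !mxE; apply/CrealP.
  by rewrite complex_real.
apply/is_hermitianmxP; rewrite expr0 scale1r /lyapunov_mx.
set AC := map_mx _ A in Ac *.
have ACc : AC^T ^ Num.conj = AC^T by rewrite -map_trmx Ac.
rewrite linearD !linearZ /= map_mxD !map_mxZ !trmx_mul !map_mxM trmxK /=.
rewrite -Ph ACc Ac conjCK addrC.
reflexivity.
Qed.

(* Main.v *)
Require Import Defs.
From mathcomp Require Import all_boot all_order all_algebra.
From mathcomp Require Import complex.
From mathcomp Require Import all_classical reals.

Import Order.TTheory GRing.Theory Num.Theory.
Local Open Scope ring_scope.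
Local Open Scope complex_scope.

(** For a fixed vector x, the number x^* (beta P A + beta^* A^T P) x is real and
linear in the entries of A, so over the box of interval matrices it is largest
at the vertex that takes the upper bound where the coefficient is nonnegative
and the lower bound elsewhere. Hence negative definiteness on the vertices
propagates to the whole box, with the same P. *)

Section HermitianForms.

Set Implicit Arguments.
Unset Strict Implicit.

Local Open Scope sesquilinear_scope.

Context {R : realType} {n : nat}.
Implicit Types (H P : 'M[R[i]]_n) (x : 'cV[R[i]]_n) (A : 'M[R]_n).

Lemma hermsymmx_form_real H x :
  H \is hermsymmx -> (x ^t* *m H *m x) 0 0 \is Num.real.
Proof.
move=> /is_hermitianmxP; rewrite expr0 scale1r => Hh.
have e : (x ^t* *m H *m x) ^t* = x ^t* *m H *m x.
  by rewrite !trmx_mul !map_mxM /= trmxCK -Hh mulmxA.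
by apply/CrealP; rewrite -[in RHS]e !mxE.
Qed.

(** Writing [H] as [U^-1 D U] with [U] unitary gives [U H = D U], so the rows of [U] are left
    eigenvectors. *)
Lemma spectral_diag_eigenvalue H i :
  H \is hermsymmx -> eigenvalue H (spectral_diag H 0 i).
Proof.
move=> /hermitian_normalmx/orthomx_spectralP HE.
apply/eigenvalueP; exists (row i (spectralmx H)).
  have e : spectralmx H *m H = diag_mx (spectral_diag H) *m spectralmx H.
    by rewrite {2}HE -mulmxA mulKVmx// spectral_unit.
  by rewrite -row_mul e row_mul row_diag_mx -scalemxAl -rowE.
(* A row of a unitary matrix has norm 1, so it cannot vanish. *)
apply/eqP => r0; have /row_unitarymxP/(_ i i) := spectral_unitarymx H.
by rewrite r0 linear0l eqxx => /eqP; rewrite eq_sym oner_eq0.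
Qed.

(** Forward, the form is evaluated at an eigenvector for [lambda_max H]. Backward, unitary
    diagonalization turns the form into a sum of [d_j |y_j|^2], where every [d_j] is at most
    [lambda_max H]. *)
Lemma negdefmx_lambda_max H : (0 < n)%N -> H \is hermsymmx ->
  negdefmx H <-> lambda_max H < 0.
Proof.
move=> n0 Hh; have [lH lub] := lambda_maxP n0 Hh; split.
  case=> _ Hneg; have /eigenvalueP[v vH v0] := lH.
  (* [eigenvalue] provides a row vector, so the column to test is its conjugate transpose. *)
  have vt0 : v ^t* != 0.
    by apply: contraNneq v0 => v0; rewrite -[v]trmxCK v0 trmx0 map_mx0.
  have := Hneg _ vt0; rewrite trmxCK vH -scalemxAl mxE.
  have vv : 0 < (v *m v ^t*) 0 0 by rewrite -dotmxE dnorm_gt0.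
  by rewrite pmulr_llt0// ltcR.
move=> l0; split=> // x x0.
have /orthomx_spectralP HE := hermitian_normalmx Hh.
pose y := spectralmx H *m x.
have y0 : y != 0.
  apply: contraNneq x0 => y0.
  by rewrite -[x](mulKmx (spectral_unit H)) -/y y0 mulmx0.
have -> : x ^t* *m H *m x = y ^t* *m diag_mx (spectral_diag H) *m y.
  rewrite {1}HE invmx_unitary ?spectral_unitarymx// /y trmx_mul map_mxM.
  by rewrite !mulmxA.
move: y y0 => y y0 {HE}.
have [k yk] : exists k, y k 0 != 0.
  apply/existsP; apply: contraNT y0 => /existsPn yk; apply/eqP/colP => k.
  by rewrite mxE; apply/eqP/negPn/yk.
have d0 j : spectral_diag H 0 j < 0.
  by apply: le_lt_trans (lub _ (spectral_diag_eigenvalue j Hh)) _; rewrite ltcR.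
(* The term at a nonzero coordinate [k] is strictly negative; the others are only nonpositive. *)
rewrite mxE (bigD1 k)//=.
have E j : (y ^t* *m diag_mx (spectral_diag H)) 0 j * y j 0 =
           spectral_diag H 0 j * `|y j 0| ^+ 2.
  by rewrite mul_mx_diag !mxE normCK mulrAC mulrC [_^* * _]mulrC.
rewrite ltr_wnDr//; last by rewrite E nmulr_rlt0// exprn_gt0// normr_gt0.
apply: sumr_le0 => j _; rewrite E.
by rewrite mulr_le0_ge0// ?(ltW (d0 j))// exprn_ge0.
Qed.

Lemma lyapunov_mx_delta beta P A :
  lyapunov_mx beta P A =
  \sum_i \sum_j (A i j)%:C *: lyapunov_mx beta P (delta_mx i j).
Proof.
rewrite /lyapunov_mx /=.
have -> : map_mx (real_complex R) A = \sum_i \sum_j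
    (A i j)%:C *: map_mx (real_complex R) (delta_mx i j).
  rewrite {1}[A]matrix_sum_delta raddf_sum; apply: eq_bigr => i _ /=.
  by rewrite raddf_sum; apply: eq_bigr => j _ /=; rewrite map_mxZ.
rewrite mulmx_sumr (raddf_sum (@trmx _ _ _))/= mulmx_suml !scaler_sumr.
rewrite -big_split/=; apply: eq_bigr => i _.
rewrite mulmx_sumr (raddf_sum (@trmx _ _ _))/= mulmx_suml !scaler_sumr.
rewrite -big_split/=; apply: eq_bigr => j _.
rewrite -scalemxAr [(_ *: _)^T]linearZ/= -scalemxAl scalerDr !scalerA.
by rewrite ![_%:C * _]mulrC.
Qed.

Lemma lyapunov_form_delta beta P A x :
  (x ^t* *m lyapunov_mx beta P A *m x) 0 0 = \sum_i \sum_j (A i j)%:C *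
    (x ^t* *m lyapunov_mx beta P (delta_mx i j) *m x) 0 0.
Proof.
rewrite {1}lyapunov_mx_delta mulmx_sumr mulmx_suml summxE.
apply: eq_bigr => i _; rewrite mulmx_sumr mulmx_suml summxE.
by apply: eq_bigr => j _; rewrite -scalemxAr -scalemxAl mxE.
Qed.

(** The vertex depends on [x]. This is harmless, as [P] is common to all vertices and negative
    definiteness is checked one vector at a time. *)
Lemma lyapunov_form_vertex_bound (S : interval_system R n) beta P A x :
  P \is hermsymmx -> interval_matrices S A ->
  exists2 V, vertex_matrices S V &
    (x ^t* *m lyapunov_mx beta P A *m x) 0 0 <=
    (x ^t* *m lyapunov_mx beta P V *m x) 0 0.
Proof.
move=> Ph SA.
pose c i j := (x ^t* *m lyapunov_mx beta P (delta_mx i j) *m x) 0 0.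
exists (\matrix_(i, j) if 0 <= c i j then upper S i j else lower S i j).
  by move=> i j; rewrite mxE; case: ifP => _; [right|left].
rewrite [leLHS]lyapunov_form_delta [leRHS]lyapunov_form_delta.
apply: ler_sum => i _; apply: ler_sum => j _.
have [lA Au] := andP (SA i j).
rewrite mxE -/(c i j); case: ifP => [c0|/negbT c0].
  by rewrite ler_wpM2r// lecR.
(* The order on [R[i]] is partial: failure of [0 <= c i j] gives [c i j < 0] only because the form
   of a Hermitian matrix is real. *)
have cR : c i j \is Num.real.
  exact/hermsymmx_form_real/lyapunov_mx_hermsym.
by rewrite ler_wnM2r ?lecR// ltW// real_ltNge// real0.
Qed.

End HermitianForms.

Lemma vertex_matrices_sub_interval (R : realType) (n : nat)
    (S : interval_system R n) A :
  (forall i j, lower S i j <= upper S i j) ->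
  vertex_matrices S A -> interval_matrices S A.
Proof. by move=> le_lu SA i j; case: (SA i j) => ->; rewrite lexx le_lu. Qed.

Theorem theorem3p2 (R : realType) (alpha : R) (n : nat) (beta : R[i])
    (alo ahi : 'M[R]_n)
    (halpha : 1 <= alpha < 2) (hn : (1 <= n)%N)
    (hle : forall i j, alo i j <= ahi i j) :
  let S := IntervalSystem alpha alo ahi in
  quadratically_stable beta S <->
  exists P : 'M[R[i]]_n, posdefmx P /\
    forall A, vertex_matrices S A -> lambda_max (lyapunov_mx beta P A) < 0.
Proof.
move=> S; split=> -[P [Ppos PA]]; exists P; split=> // A SA;
  have Lh B := lyapunov_mx_hermsym beta B (proj1 Ppos).
  apply/(negdefmx_lambda_max hn (Lh _))/PA.
  exact: vertex_matrices_sub_interval SA.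
split=> // x x0.
have [V SV] := lyapunov_form_vertex_bound beta x (proj1 Ppos) SA.
move=> /le_lt_trans; apply.
by have /(negdefmx_lambda_max hn (Lh V))[_] := PA V SV; apply.
Qed.
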